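(* Let $L\subset\mathbb{R}^n$ be an $n$-dimensional lattice, let $B=[b_1|\dots|b_n]^t$ be a basis of $L$, and write $B=D\cdot V$ where $D=\mathrm{diag}(\|b_1\|,\dots,\|b_n\|)$. Then $$S(B)=\frac{\kappa(V)^2}{n},$$ where $S(B)$ is the Seysen measure of $B$ and $\kappa(V)$ is the Frobenius condition number of $V$.
   Context: An $n$-dimensional lattice $L\subset\mathbb{R}^n$ is a set $L=\{\sum_{i=1}^n a_i b_i : a_i\in\mathbb{Z}\}$ with $b_1,\dots,b_n\in\mathbb{R}^n$ linearly independent over $\mathbb{R}$. A basis of $L$ is identified with the matrix $B=[b_1|\dots|b_n]^t$ whose rows $b_i$ are linearly independent and generate $L$ over $\mathbb{Z}$. The dual basis is $B^*=(B^{-1})^t=[b_1^*|\dots|b_n^*]^t$, so that $\langle b_i,b_j^*\rangle=\delta_{i,j}$. The Seysen measure of $B$ is $S(B)=\sum_{i=1}^n\|b_i\|^2\,\|b_i^*\|^2$, where $\|\cdot\|$ is the Euclidean norm on vectors. For an invertible matrix $X$, the Frobenius condition number is $\kappa(X)=\|X\|\cdot\|X^{-1}\|$, where for matrices $\|X\|=\sqrt{\sum_{i,j}|x_{ij}|^2}$ is the Frobenius norm. *)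

(* Defs.v *)
From HB Require Import structures.
From mathcomp Require Import all_boot all_order all_algebra.
From mathcomp Require Import classical_sets reals.

Set Implicit Arguments.
Unset Strict Implicit.
Unset Printing Implicit Defensive.

Import Order.TTheory GRing.Theory Num.Theory.

Local Open Scope classical_set_scope.
Local Open Scope ring_scope.

(* Vectors of R^n are row vectors. The canonical norm `|_| that MathComp-Analysis
   puts on matrices is the sup norm, so both norms are defined here. *)
Definition frobenius_norm (R : realType) (m n : nat) (X : 'M[R]_(m, n)) : R :=
  Num.sqrt (\sum_(i < m) \sum_(j < n) `|X i j| ^+ 2).

Definition euclidean_norm (R : realType) (n : nat) (v : 'rV[R]_n) : R :=
  Num.sqrt (\sum_(j < n) `|v 0 j| ^+ 2).

(* row_free B: the rows of B are linearly independent over R.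
   inIntSpan s v: v is an integral linear combination of the entries of s. *)
Definition lattice_basis (R : realType) (n : nat)
    (L : set 'rV[R]_n) (B : 'M[R]_n) : Prop :=
  row_free B /\ L = [set v | inIntSpan [tuple row i B | i < n] v].

Definition is_lattice (R : realType) (n : nat) (L : set 'rV[R]_n) : Prop :=
  exists B : 'M[R]_n, lattice_basis L B.

Definition dual_basis (R : realType) (n : nat) (B : 'M[R]_n) : 'M[R]_n :=
  (invmx B)^T.

Definition seysen_measure (R : realType) (n : nat) (B : 'M[R]_n) : R :=
  \sum_(i < n)
    euclidean_norm (row i B) ^+ 2 * euclidean_norm (row i (dual_basis B)) ^+ 2.

(* Meaningful for X \in unitmx only: otherwise invmx X is X. *)
Definition frobenius_cond (R : realType) (n : nat) (X : 'M[R]_n) : R :=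
  frobenius_norm X * frobenius_norm (invmx X).

Definition row_norm_mx (R : realType) (n : nat) (B : 'M[R]_n) : 'M[R]_n :=
  diag_mx (\row_(i < n) euclidean_norm (row i B)).

(* Main.v *)
(* The rows of V are unit vectors, so ||V||^2 = n. The columns of
   V^-1 = B^-1 D are the dual vectors b_i^* scaled by ||b_i||, so
   ||V^-1||^2 = S(B). *)
Require Import Defs.
From mathcomp Require Import all_boot all_order all_algebra.
From mathcomp Require Import classical_sets reals.

Import Order.TTheory GRing.Theory Num.Theory.
Local Open Scope ring_scope.

(** Squaring removes the roots, so [kappa(V)^2] is the product of the entrywise sums of squares of
    [V] and of [V^-1]. By [sqr_frobenius_norm_row_normalized] the first is [n]; by
    [sqr_frobenius_norm_inv_row_normalized] the second, summed column by column, is [S(B)]. *)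

Lemma sqr_euclidean_norm (R : realType) (n : nat) (v : 'rV[R]_n) :
  euclidean_norm v ^+ 2 = \sum_(j < n) v 0 j ^+ 2.
Proof.
rewrite /euclidean_norm sqr_sqrtr; last by apply: sumr_ge0 => j _; exact: sqr_ge0.
by apply: eq_bigr => j _; rewrite real_normK ?num_real.
Qed.

Lemma sqr_frobenius_norm (R : realType) (m n : nat) (X : 'M[R]_(m, n)) :
  frobenius_norm X ^+ 2 = \sum_(i < m) \sum_(j < n) X i j ^+ 2.
Proof.
rewrite /frobenius_norm sqr_sqrtr.
  by do 2![apply: eq_bigr => ? _]; rewrite real_normK ?num_real.
by apply: sumr_ge0 => i _; apply: sumr_ge0 => j _; exact: sqr_ge0.
Qed.

Lemma euclidean_norm_eq0 (R : realType) (n : nat) (v : 'rV[R]_n) :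
  (euclidean_norm v == 0) = (v == 0).
Proof.
rewrite -sqrf_eq0 sqr_euclidean_norm psumr_eq0; last by move=> j _; exact: sqr_ge0.
apply/allP/eqP => [v0|-> j _]; last by rewrite /= mxE expr0n eqxx.
by apply/rowP => j; apply/eqP; rewrite mxE -sqrf_eq0 (implyP (v0 j _)) ?mem_index_enum.
Qed.

(** A zero row of [A] would give a zero row of [A *m invmx A], the identity. *)
Lemma row_unitmx_neq0 (F : fieldType) (n : nat) (A : 'M[F]_n) (i : 'I_n) :
  A \in unitmx -> row i A != 0.
Proof.
move=> uA; apply/eqP => Ai0.
have /rowP/(_ i)/eqP : row i (1%:M : 'M[F]_n) = 0.
  by rewrite -(mulmxV uA) row_mul Ai0 mul0mx.
by rewrite !mxE eqxx oner_eq0.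
Qed.

Lemma sqr_frobenius_norm_row_normalized (R : realType) (n : nat)
    (B V : 'M[R]_n) :
  B \in unitmx -> B = row_norm_mx B *m V -> frobenius_norm V ^+ 2 = n%:R.
Proof.
move=> uB hV; rewrite sqr_frobenius_norm -[n in RHS]card_ord -sumr_const.
apply: eq_bigr => i _.
have d_neq0 : euclidean_norm (row i B) ^+ 2 != 0.
  by rewrite sqrf_eq0 euclidean_norm_eq0 row_unitmx_neq0.
(* Scaled by [||b_i||^2], row [i] of [V] becomes row [i] of [B], since [||b_i|| V i j = B i j]. *)
apply: (mulfI d_neq0); rewrite mulr1 [RHS]sqr_euclidean_norm mulr_sumr.
by apply: eq_bigr => j _; rewrite -exprMn [in RHS]hV mxE mul_diag_mx !mxE.
Qed.

Lemma sqr_frobenius_norm_inv_row_normalized (R : realType) (n : nat)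
    (B V : 'M[R]_n) :
  B \in unitmx -> B = row_norm_mx B *m V ->
  frobenius_norm (invmx V) ^+ 2 = seysen_measure B.
Proof.
move=> uB hV.
(* A one-sided inverse of a square matrix suffices: [V] is a unit, so [invmx V] is its true
   inverse. *)
have BDV : invmx B *m row_norm_mx B *m V = 1%:M by rewrite -mulmxA -hV mulVmx.
have [_ uV] := mulmx1_unit BDV.
have -> : invmx V = invmx B *m row_norm_mx B by rewrite -[RHS](mulmxK uV) BDV mul1mx.
(* Dual vectors are columns of [invmx B], hence the swap of the sums. *)
rewrite sqr_frobenius_norm exchange_big; apply: eq_bigr => i _.
rewrite [euclidean_norm (row i (dual_basis B)) ^+ 2]sqr_euclidean_norm mulr_sumr.
by apply: eq_bigr => j _; rewrite mul_mx_diag !mxE exprMn mulrC.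
Qed.

Theorem corollary3p2 (R : realType) (n : nat) (hn : (0 < n)%N)
    (L : set 'rV[R]_n) (hL : is_lattice L)
    (B : 'M[R]_n) (hB : lattice_basis L B)
    (V : 'M[R]_n) (hV : B = row_norm_mx B *m V) :
  seysen_measure B = frobenius_cond V ^+ 2 / n%:R.
Proof.
have uB : B \in unitmx by case: hB => + _; rewrite row_free_unit.
rewrite exprMn (sqr_frobenius_norm_row_normalized _ _ _ _ uB hV).
rewrite (sqr_frobenius_norm_inv_row_normalized _ _ _ _ uB hV).
by rewrite mulrC mulKf // pnatr_eq0 -lt0n.
Qed.
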